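(* Let $d\mu=\frac{e^{-U}}{Z}d\lambda$ be a probability measure on $\mathbb{R}^N$, and suppose that for some $\beta>0$ and constants $A,B$ the inequality $$\mu\left(|f|\,|U|^\beta\right)\le A\,\mu|\nabla f|+B\,\mu|f|$$ is satisfied for all $f$. Suppose also that (a) for any $L\ge 0$ there exists $r=r(L)\in(0,\infty)$ such that $\{|U|^\beta\le L\}\subset B(r)$; (b) for $r=r(L)$ there exists $m_r\in(0,\infty)$ such that the following Poincaré inequality in the ball $B(r)$ is satisfied for all $f$: $$\int_{B(r)}\left|f-\frac{1}{\lambda(B(r))}\int_{B(r)}f\,d\lambda\right|d\lambda\le\frac{1}{m_r}\int_{B(r)}|\nabla f|\,d\lambda .$$ Then there exists a constant $c_0$ such that for all $f$ $$\mu|f-\mu f|\le c_0\,\mu|\nabla f| .$$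
   Context: $\mathbb{R}^N$ is equipped with Lebesgue measure $\lambda$ and a metric $d:\mathbb{R}^N\times\mathbb{R}^N\to[0,\infty)$; $d(x):=d(x,0)$ and $B(r):=\{x:d(x)\le r\}$. $U$ is a real function on $\mathbb{R}^N$ and $Z=\int e^{-U}d\lambda$ is the normalisation constant. $\nabla=(X_1,\dots,X_m)$ is a sub-gradient, i.e. a finite family of (possibly non-commuting) vector fields on $\mathbb{R}^N$, each with zero divergence with respect to $\lambda$, and $|\nabla f|=\left(\sum_{i=1}^m (X_if)^2\right)^{1/2}$. We write $\mu f=\mu(f)=\int f\,d\mu$. ''For all $f$'' means for all real functions $f$ for which the right-hand side is well defined.
   Formalization: The formal theorem additionally assumes that U is bounded above on each ball B(r(L)); without this the claim fails, e.g. for N=1, U(x)=x²−2log|x|, β=1/2, where μ has density proportional to x²e^{−x²}. *)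

(* Defs.v *)
From HB Require Import structures.
From mathcomp Require Import all_boot all_order all_algebra.
From mathcomp Require Import all_classical all_reals all_analysis.
From mathcomp Require Import measurable_realfun lra.

Set Implicit Arguments.
Unset Strict Implicit.
Unset Printing Implicit Defensive.

Import Order.TTheory GRing.Theory Num.Theory.
Import numFieldNormedType.Exports.

Local Open Scope classical_set_scope.
Local Open Scope ring_scope.

HB.instance Definition _ (R : realType) (n : nat) :=
  Measurable.copy 'rV[R]_n (g_sigma_algebraType (@open 'rV[R]_n)).

Lemma open_measurable_rV (R : realType) (n : nat) (A : set 'rV[R]_n) :
  open A -> measurable A.
Proof. by move=> oA; exact: sub_sigma_algebra. Qed.

Lemma measurable_coord (R : realType) (n : nat) (i : 'I_n) :
  measurable_fun setT (fun v : 'rV[R]_n => v ord0 i).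
Proof.
apply: (measurability (@RGenOpens.G R)); first exact: RGenOpens.measurableE.
move=> _ [_ [x [y ->]] <-]; rewrite setTI; apply: open_measurable_rV.
apply: open_comp; last exact: interval_open.
by move=> v _; exact: coord_continuous.
Qed.

Lemma open_bigcup_cube (R : realType) (n : nat) (U : set 'rV[R]_n) : open U ->
  U = \bigcup_(q in [set q : 'rV[rat]_n * rat |
        0 < q.2 /\ ball (map_mx ratr q.1 : 'rV[R]_n) (ratr q.2) `<=` U])
      ball (map_mx ratr q.1 : 'rV[R]_n) (ratr q.2).
Proof.
move=> oU; apply/seteqP; split; last by move=> x [q /= [_ qU]]; exact: qU.
move=> x Ux; have /nbhs_ballP[e /= e0 eU] := open_nbhs_nbhs (conj oU Ux).
have [r] := rat_in_itvoo (divr_gt0 e0 (@ltr0n R 2)).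
rewrite in_itv/= => /andP[r0 re].
have /choice[c cP] : forall i : 'I_n, exists q : rat,
    ratr q \in `](x ord0 i - ratr r : R), (x ord0 i + ratr r)[.
  by move=> i; apply: rat_in_itvoo; lra.
have xc : ball (map_mx ratr (\row_i c i) : 'rV[R]_n) (ratr r) x.
  split=> // i j; rewrite ord1 !mxE /ball/=.
  by have := cP j; rewrite in_itv/= ltr_distl.
exists (\row_i c i, r) => //=; split; first by move: r0; rewrite ltr0q.
move=> y cy; apply: eU; apply: (@le_ball _ _ _ (ratr r + ratr r)); first by lra.
by apply: ball_triangle cy; exact: ball_sym.
Qed.

Lemma measurable_fun_rV d (T : measurableType d) (R : realType) (n : nat)
    (f : T -> 'rV[R]_n) :
  (forall i, measurable_fun setT (fun x => f x ord0 i)) ->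
  measurable_fun setT f.
Proof.
move=> mf; apply: (measurability (@open 'rV[R]_n)) => //.
move=> _ [U oU <-]; rewrite setTI (open_bigcup_cube oU) preimage_bigcup.
rewrite bigcup_mkcond; apply: countable_bigcupT_measurable => [|[c r]].
  exact: countableP.
case: ifPn => [|_]; last exact: measurable0.
rewrite inE/= => -[r0 _].
rewrite (_ : _ @^-1` _ = \bigcap_(i in [set: 'I_n])
    ((fun x => f x ord0 i) @^-1` ball (ratr (c ord0 i) : R) (ratr r))).
  apply: fin_bigcap_measurable => [|i _]; first exact: finite_finset.
  by rewrite -[X in measurable X]setTI; apply: mf => //; exact: measurable_ball.
apply/seteqP; split=> [x [_ fx] i _|x fx].
  by have := fx ord0 i; rewrite mxE.
split; first by rewrite ltr0q.
by move=> i j; rewrite ord1 mxE; exact: fx.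
Qed.

Definition cons_rV (R : realType) (n : nat) (p : R * 'rV[R]_n) : 'rV[R]_n.+1 :=
  \row_i (if unlift ord0 i is Some j then p.2 ord0 j else p.1).

Lemma measurable_cons_rV (R : realType) (n : nat) :
  measurable_fun setT (@cons_rV R n).
Proof.
apply: measurable_fun_rV => i.
have [j ->|->] := unliftP ord0 i.
  apply: (eq_measurable_fun ((fun v : 'rV[R]_n => v ord0 j) \o snd)).
    by move=> p _; rewrite mxE liftK.
  by apply: measurableT_comp; [exact: measurable_coord|exact: measurable_snd].
apply: (eq_measurable_fun fst); last exact: measurable_fst.
by move=> p _; rewrite mxE unlift_none.
Qed.

Section cons_measure.
Context (R : realType) (n : nat).
Variable m : {sigma_finite_measure set 'rV[R]_n -> \bar R}.

Definition cons_measure : set 'rV[R]_n.+1 -> \bar R :=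
  pushforward (@lebesgue_measure R \x m)%E (@cons_rV R n).

Let cons_measure0 : cons_measure set0 = 0%E.
Proof. by rewrite /cons_measure /pushforward preimage_set0 measure0. Qed.

Let cons_measure_ge0 A : (0 <= cons_measure A)%E.
Proof. by rewrite /cons_measure /pushforward measure_ge0. Qed.

Let measurable_preimage_cons A :
  measurable A -> measurable (@cons_rV R n @^-1` A).
Proof.
by move=> mA; rewrite -[X in measurable X]setTI; exact: measurable_cons_rV.
Qed.

Let cons_measure_sigma_additive : semi_sigma_additive cons_measure.
Proof.
move=> F mF tF mUF; rewrite /cons_measure /pushforward preimage_bigcup.
apply: measure_semi_sigma_additive.
- by move=> i; exact: measurable_preimage_cons.
- apply/trivIsetP => /= i j _ _ ij; rewrite -preimage_setI.
  by move/trivIsetP : tF => /(_ _ _ _ _ ij) ->//; rewrite preimage_set0.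
- by rewrite -preimage_bigcup; exact: measurable_preimage_cons.
Qed.

HB.instance Definition _ := isMeasure.Build _ _ _ cons_measure
  cons_measure0 cons_measure_ge0 cons_measure_sigma_additive.

Let cons_measure_sigma_finite : sigma_finite setT cons_measure.
Proof.
have /sigma_finiteP[F [TF ndF Foo]] := sigma_finiteT (@lebesgue_measure R).
have /sigma_finiteP[G [TG ndG Goo]] := sigma_finiteT m.
pose g (v : 'rV[R]_n.+1) : R * 'rV[R]_n := (v ord0 ord0, \row_j v ord0 (lift ord0 j)).
have gK : cancel (@cons_rV R n) g.
  move=> [x v]; rewrite /g /cons_rV !mxE unlift_none; congr (_, _).
  by apply/rowP => j; rewrite !mxE liftK.
have mg : measurable_fun setT g.
  apply/measurable_fun_pairP; split; first exact: measurable_coord.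
  apply: measurable_fun_rV => j.
  apply: (eq_measurable_fun (fun v : 'rV[R]_n.+1 => v ord0 (lift ord0 j))).
    by move=> v _; rewrite /= mxE.
  exact: measurable_coord.
exists (fun k => g @^-1` (F k `*` G k)).
  rewrite -preimage_bigcup (_ : \bigcup_k _ = setT) ?preimage_setT//.
  apply/seteqP; split=> // -[x v] _.
  have [i _ Fix] : (\bigcup_k F k) x by rewrite -TF.
  have [j _ Gjv] : (\bigcup_k G k) v by rewrite -TG.
  exists (maxn i j) => //; split => /=.
    by move: x Fix; exact/subsetPset/ndF/leq_maxl.
  by move: v Gjv; exact/subsetPset/ndG/leq_maxr.
move=> k; have [mF Fkoo] := Foo k; have [mG Gkoo] := Goo k; split.
  by rewrite -[X in measurable X]setTI; apply: mg => //; exact: measurableX.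
rewrite /cons_measure /pushforward -comp_preimage.
rewrite (_ : g \o _ = id) ?preimage_id; last by apply/funext => p /=; exact: gK.
by rewrite product_measure1E// lte_mul_pinfty// ge0_fin_numE.
Qed.

HB.instance Definition _ := Measure_isSigmaFinite.Build _ _ _ cons_measure
  cons_measure_sigma_finite.

End cons_measure.

Fixpoint lebesgue_rV (R : realType) (n : nat) :
    {sigma_finite_measure set 'rV[R]_n -> \bar R} :=
  match n with
  | 0%N => \d_(0 : 'rV[R]_0)
  | n'.+1 => cons_measure (lebesgue_rV R n')
  end.

Lemma lebesgue_rV_box (R : realType) (n : nat) (a b : 'rV[R]_n) :
  (forall i, a ord0 i <= b ord0 i) ->
  lebesgue_rV R n [set v | forall i, v ord0 i \in `[a ord0 i, b ord0 i]] =
  (\prod_i (b ord0 i - a ord0 i))%:E.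
Proof.
elim: n a b => [|n ih] a b ab.
  by rewrite big_ord0 /= diracE mem_set// => -[].
rewrite big_ord_recl EFinM.
pose a' := \row_j a ord0 (lift ord0 j); pose b' := \row_j b ord0 (lift ord0 j).
have := ih a' b'; under eq_bigr do rewrite !mxE.
move=> <-; last by move=> i; rewrite !mxE.
pose B' := [set v : 'rV[R]_n | forall i, v ord0 i \in `[a' ord0 i, b' ord0 i]].
have mB' : measurable B'.
  rewrite (_ : B' = \bigcap_(i in [set: 'I_n])
      ((fun v : 'rV[R]_n => v ord0 i) @^-1` `[a' ord0 i, b' ord0 i])).
    apply: fin_bigcap_measurable => [|i _]; first exact: finite_finset.
    by rewrite -[X in measurable X]setTI; exact: measurable_coord.
  by apply/seteqP; split=> v vB i => [_|]; exact: vB.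
have boxE : @cons_rV R n @^-1`
    [set v | forall i, v ord0 i \in `[a ord0 i, b ord0 i]] =
    `[a ord0 ord0, b ord0 ord0]%classic `*` B'.
  apply/seteqP; split=> [[x v] /= vab|[x v] [/= xab vab] i].
    split=> [|i]; first by have := vab ord0; rewrite mxE unlift_none.
    by have := vab (lift ord0 i); rewrite !mxE liftK.
  have [j ->|->] := unliftP ord0 i; last by rewrite mxE unlift_none.
  by have := vab j; rewrite !mxE liftK.
rewrite /= /cons_measure /pushforward boxE product_measure1E//.
congr (_ * _)%E.
apply: etrans (lebesgue_measure_itv `[a ord0 ord0, b ord0 ord0]) _ => /=.
by rewrite lte_fin -EFinD; case: ltgtP (ab ord0) => // ->; rewrite subrr.
Qed.

Section sub_gradient.
Context (R : realType) (N : nat).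
Implicit Types (V : 'rV[R]_N -> 'rV[R]_N) (f U : 'rV[R]_N -> R).

Definition divergence V (x : 'rV[R]_N) : R :=
  \sum_(j < N) 'D_(delta_mx ord0 j) (fun y => V y ord0 j) x.

(* For differentiable f, 'D_(X i x) f x is the value at x of the vector field
   X_i = \sum_j a_ij d/dx_j applied to f, where a_ij(x) = X i x ord0 j. *)
Definition subgrad_norm (m : nat) (X : 'I_m -> 'rV[R]_N -> 'rV[R]_N) f
    (x : 'rV[R]_N) : R :=
  Num.sqrt (\sum_(i < m) ('D_(X i x) f x) ^+ 2).

Definition is_metric (d : 'rV[R]_N -> 'rV[R]_N -> R) : Prop :=
  [/\ forall x y, 0 <= d x y,
      forall x y, d x y = 0 <-> x = y,
      forall x y, d x y = d y x
    & forall x y z, d x z <= d x y + d y z].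

Definition dball (d : 'rV[R]_N -> 'rV[R]_N -> R) (r : R) : set 'rV[R]_N :=
  [set x | d x 0 <= r].

Definition normalisation U : R := \int[lebesgue_rV R N]_x expR (- U x).

(* d mu = (e^{-U} / Z) d lambda. When e^{-U} is not integrable, the
   normalisation above is 0, and so is the density; no probability measure
   has it. *)
Definition has_gibbs_density U (mu : set 'rV[R]_N -> \bar R) : Prop :=
  forall S, measurable S ->
    mu S = (\int[lebesgue_rV R N]_(x in S) (expR (- U x) / normalisation U)%:E)%E.

(* fine +oo = 0 and 0^-1 = 0: the mean is 0 on sets of infinite measure *)
Definition lebesgue_mean (S : set 'rV[R]_N) f : R :=
  (fine (lebesgue_rV R N S))^-1 * \int[lebesgue_rV R N]_(x in S) f x.

End sub_gradient.

(* Main.v *)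
Require Import Defs.
From mathcomp Require Import all_boot all_order all_algebra.
From mathcomp Require Import all_classical all_reals all_analysis.
From mathcomp Require Import measurable_realfun ring lra.
Import Order.TTheory GRing.Theory Num.Theory.
Import numFieldNormedType.Exports.
Local Open Scope classical_set_scope.
Local Open Scope ring_scope.

Set Implicit Arguments.
Unset Strict Implicit.
Unset Printing Implicit Defensive.

(** Let [c] be the Lebesgue mean of [f] over the ball [B(r)] that contains
    [{|U|^beta <= L}]. Since [mu|f - mu f| <= 2 mu|f - c|], it suffices to bound
    [mu|f - c|]. On [{|U|^beta <= L}] the density of [mu] is bounded above, and
    on [B(r)] it is bounded below, so the Poincare inequality of the ball
    controls the integral of [|f - c|] over [{|U|^beta <= L}] by [mu|grad f|].
    On [{|U|^beta > L}] the integral is at most [mu(|f - c| |U|^beta) / L]; for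
    [L >= 2|B|] the term [B mu|f - c|] produced by the hypothesis is absorbed.
    Absorption requires [f - c] to be integrable, which is not known: it is
    carried out for the bounded functions [g / (1 + g^2 / n)] with [g = f - c],
    whose gradients are dominated by that of [f], and [n] tends to infinity. *)

(** Restricting both measures to [D] with [mrestr] extends the comparison from subsets of [D] to all
    measurable sets. *)
Lemma ge0_le_measure_integral_in d (T : measurableType d) (R : realType)
    (m1 m2 : {measure set T -> \bar R}) (D : set T) (f : T -> \bar R) :
  measurable D ->
  (forall S, measurable S -> S `<=` D -> (m1 S <= m2 S)%E) ->
  (forall x, (0 <= f x)%E) -> measurable_fun [set: T] f ->
  (\int[m1]_(x in D) f x <= \int[m2]_(x in D) f x)%E.
Proof.
move=> mD m12 f0 mf.
rewrite (eq_measure_integral (mrestr m1 mD)); last first.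
  by move=> S _ SD; rewrite /= /mrestr setIidl.
rewrite [leRHS](eq_measure_integral (mrestr m2 mD)); last first.
  by move=> S _ SD; rewrite /= /mrestr setIidl.
apply: ge0_le_measure_integral => // S mS.
by apply: m12; [exact: measurableI|exact: subIsetr].
Qed.

(** * Derivatives along vector fields: measurability and the chain rule *)

Lemma continuous_rV_measurable_fun (R : realType) (N : nat)
    (f : 'rV[R]_N -> R) :
  continuous f -> measurable_fun [set: 'rV[R]_N] f.
Proof.
move=> cf; apply: (measurability (@RGenOpens.G R)).
  exact: RGenOpens.measurableE.
move=> _ [_ [x [y ->]] <-]; rewrite setTI; apply: open_measurable_rV.
by apply: open_comp; [move=> v _; exact: cf|exact: interval_open].
Qed.

(** The derivative is the pointwise limit of the difference quotients with step [harmonic n], which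
    are continuous because [f] and [V] are. *)
Lemma measurable_fun_derive (R : realType) (N : nat) (f : 'rV[R]_N -> R)
    (V : 'rV[R]_N -> 'rV[R]_N) :
  (forall x, differentiable f x) -> continuous V ->
  measurable_fun [set: 'rV[R]_N] (fun x => 'D_(V x) f x).
Proof.
move=> df cV; have cf : continuous f.
  by move=> x; exact: differentiable_continuous.
pose h (n : nat) x : R := (harmonic n)^-1 * (f (harmonic n *: V x + x) - f x).
apply: (@measurable_fun_cvg _ _ _ _ h) => [n|x _].
  apply: continuous_rV_measurable_fun => x.
  pose q y := harmonic n *: V y + y.
  apply: (@continuousM _ _ (fun=> (harmonic n)^-1) (fun y => f (q y) - f y)).
    exact: cst_continuous.
  apply: (@continuousB _ _ _ (f \o q) f); last exact: cf.
  apply: (@continuous_comp _ _ _ q); last exact: cf.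
  apply: (@continuousD _ _ _ (fun y => harmonic n *: V y) id).
    by apply: (@continuousZl_tmp _ _ _ V); exact: cV.
  exact: cvg_id.
have /cvg_ex[l fl] : derivable f x (V x) by exact: diff_derivable.
have -> : 'D_(V x) f x = l by exact: cvg_lim fl.
move/cvgr_dnbhsP : fl; apply; split; last exact: cvg_harmonic.
by move=> n; rewrite gt_eqF// harmonic_gt0.
Qed.

Lemma measurable_subgrad_norm (R : realType) (N m : nat)
    (X : 'I_m -> 'rV[R]_N -> 'rV[R]_N) (f : 'rV[R]_N -> R) :
  (forall i, continuous (X i)) -> (forall x, differentiable f x) ->
  measurable_fun [set: 'rV[R]_N] (subgrad_norm X f).
Proof.
move=> cX df; apply: (measurableT_comp (continuous_measurable_fun _)).
  exact: sqrt_continuous.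
apply: measurable_sum => i; apply: measurable_funX.
exact: measurable_fun_derive.
Qed.

(** By the chain rule, each derivative of [phi \o f] along [X i] is that of [f] times a factor of
    modulus at most 1. *)
Lemma subgrad_norm_comp_le (R : realType) (N m : nat)
    (X : 'I_m -> 'rV[R]_N -> 'rV[R]_N) (f : 'rV[R]_N -> R) (phi : R -> R)
    (x : 'rV[R]_N) :
  differentiable f x -> differentiable phi (f x) -> `|'D_1 phi (f x)| <= 1 ->
  subgrad_norm X (phi \o f) x <= subgrad_norm X f x.
Proof.
move=> df dphi phi1; rewrite /subgrad_norm ler_wsqrtr//; apply: ler_sum => i _.
have -> : 'D_(X i x) (phi \o f) x = 'D_(X i x) f x * 'D_1 phi (f x).
  rewrite !deriveE//; last exact: differentiable_comp.
  (* The increment is written as itself times 1, so that linearity of ['d phi (f x)] leaves its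
     value at 1. *)
  rewrite diff_comp//= -[in LHS](mulr1 ('d f x (X i x))).
  exact: (linearZ_LR (('d phi (f x)) : {linear R -> R}) ('d f x (X i x)) 1).
rewrite exprMn -[leRHS]mulr1 ler_wpM2l ?sqr_ge0//.
by rewrite -[leLHS]ger0_norm ?sqr_ge0// normrX exprn_ile1.
Qed.

Lemma subgrad_norm_ge0 (R : realType) (N m : nat)
    (X : 'I_m -> 'rV[R]_N -> 'rV[R]_N) (f : 'rV[R]_N -> R) (x : 'rV[R]_N) :
  0 <= subgrad_norm X f x.
Proof. exact: sqrtr_ge0. Qed.

(** * Damping functions *)

(** A differentiable replacement for truncation, so that composing with it yields test functions
    again. For [0 < e <= 1] it is bounded with slope at most 1 in modulus, and its modulus increases
    to [|t|] as [e] decreases to 0. *)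
Definition damp (R : realType) (e t : R) : R := t / (1 + e * t ^+ 2).

Lemma damp_denom_gt0 (R : realType) (e t : R) : 0 <= e ->
  0 < 1 + e * t ^+ 2.
Proof. by move=> e0; rewrite ltr_pwDl// mulr_ge0 ?sqr_ge0. Qed.

Lemma normr_damp (R : realType) (e t : R) : 0 <= e ->
  `|damp e t| = `|t| / (1 + e * t ^+ 2).
Proof.
by move=> e0; rewrite normrM normfV (gtr0_norm (damp_denom_gt0 t e0)).
Qed.

Lemma normr_damp_ub (R : realType) (e t : R) : 0 < e <= 1 ->
  `|damp e t| <= e^-1.
Proof.
move=> /andP[e0 e1]; rewrite normr_damp ?(ltW e0)//.
rewrite ler_pdivrMr ?damp_denom_gt0 ?(ltW e0)//.
rewrite mulrDr mulr1 mulKf ?gt_eqF//.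
(* The claim is now [|t| <= e^-1 + t^2]; since [e^-1 >= 1], it follows from [|t| <= 1 + t^2]. *)
have : 1 <= e^-1 by rewrite invf_ge1.
by rewrite -(real_normK (num_real t)); nra.
Qed.

Lemma normr_damp_le (R : realType) (e1 e2 t : R) : 0 <= e1 -> e1 <= e2 ->
  `|damp e2 t| <= `|damp e1 t|.
Proof.
move=> e10 e12; have e20 := le_trans e10 e12.
rewrite !normr_damp//; apply: ler_wpM2l => //.
rewrite lef_pV2 ?posrE ?damp_denom_gt0//.
by rewrite lerD2l ler_wpM2r ?sqr_ge0.
Qed.

Lemma damp0 (R : realType) (t : R) : damp 0 t = t.
Proof. by rewrite /damp mul0r addr0 divr1. Qed.

Lemma is_derive_damp (R : realType) (e t : R) : 0 <= e ->
  is_derive t 1 (damp e) ((1 - e * t ^+ 2) / (1 + e * t ^+ 2) ^+ 2).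
Proof.
move=> e0; have et : 1 + e * t ^+ 2 != 0.
  by rewrite gt_eqF// ltr_pwDl// mulr_ge0 ?sqr_ge0.
pose g (u : R) : R := 1 + e * u ^+ 2.
have dg : is_derive t 1 g (e * (2 * t)).
  rewrite (_ : g = cst 1 + e \*: (id ^+ 2 : R -> R)); last by apply/funext.
  by apply: is_derive_eq; rewrite add0r /= expr1 [_ *: 1]mulr1.
rewrite (_ : damp e = id * (fun u => (g u)^-1)); last by apply/funext.
have dV : is_derive t 1 (fun u => (g u)^-1) (- (g t) ^- 2 *: (e * (2 * t))).
  by apply: is_deriveV.
apply: is_derive_eq.
rewrite /GRing.scale /= /g; field.
by rewrite et.
Qed.

Lemma derive_damp_le1 (R : realType) (e c t : R) : 0 <= e ->
  derivable (fun u => damp e (u - c)) t 1 /\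
  `|'D_1 (fun u => damp e (u - c)) t| <= 1.
Proof.
move=> e0; have [df dE] : is_derive t 1 (fun u => damp e (u - c))
    ((1 - e * (t - c) ^+ 2) / (1 + e * (t - c) ^+ 2) ^+ 2 * 1).
  apply: (@is_derive1_comp _ (damp e) (fun u => u - c)).
    exact: is_derive_damp.
  by apply: is_derive_eq; rewrite subr0.
split=> //; rewrite dE mulr1.
have := damp_denom_gt0 (t - c) e0.
have : 0 <= e * (t - c) ^+ 2 by rewrite mulr_ge0 ?sqr_ge0.
(* With [s = e (t - c)^2 >= 0], the bound is [|1 - s| <= 1 + s <= (1 + s)^2]. *)
set s := e * _ => s0 s1; rewrite normrM normfV.
rewrite [X in _ / X]gtr0_norm ?exprn_gt0// ler_pdivrMr ?exprn_gt0// mul1r.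
by rewrite ler_norml; apply/andP; split; nra.
Qed.

Lemma cvg_damp (R : realType) (t : R) :
  damp (harmonic n) t @[n --> \oo] --> t.
Proof.
rewrite -[X in _ --> X]divr1; apply: cvgM; first exact: cvg_cst.
apply: cvgV; first by rewrite oner_eq0.
rewrite -[X in _ --> X]addr0; apply: cvgD; first exact: cvg_cst.
rewrite -[X in _ --> X](mul0r (t ^+ 2)); apply: cvgM; last exact: cvg_cst.
exact: cvg_harmonic.
Qed.

(** * Integral estimates: densities, means, level sets and removal of the damping *)

Lemma integral_density_le d (T : measurableType d) (R : realType)
    (mu nu : {measure set T -> \bar R}) (p : T -> R) (K : R) (D : set T)
    (f : T -> \bar R) :
  (forall S, measurable S -> mu S = (\int[nu]_(x in S) (p x)%:E)%E) ->
  measurable_fun [set: T] p -> (forall x, 0 <= p x) -> measurable D ->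
  (forall x, D x -> p x <= K) -> 0 <= K ->
  (forall x, (0 <= f x)%E) -> measurable_fun [set: T] f ->
  (\int[mu]_(x in D) f x <= K%:E * \int[nu]_(x in D) f x)%E.
Proof.
move=> mup mp p0 mD pK K0 f0 mf.
(* The constant becomes a scaling of [nu], so only the measures of subsets of [D] have to be
   compared. *)
rewrite -[K]/(NngNum K0)%:num -ge0_integral_mscale//; last exact: measurable_funTS.
apply: ge0_le_measure_integral_in => // S mS SD.
rewrite mup//; apply: (@le_trans _ _ (\int[nu]_(x in S) cst K%:E x)%E);
  last by rewrite integral_cst.
apply: ge0_le_integral => //.
- by move=> x _; rewrite lee_fin.
- exact/measurable_EFinP/measurable_funTS.
- by move=> x /SD /pK; rewrite lee_fin.
Qed.

Lemma integral_density_ge d (T : measurableType d) (R : realType)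
    (mu nu : {measure set T -> \bar R}) (p : T -> R) (k : R) (D : set T)
    (f : T -> \bar R) :
  (forall S, measurable S -> mu S = (\int[nu]_(x in S) (p x)%:E)%E) ->
  measurable_fun [set: T] p -> measurable D ->
  (forall x, D x -> k <= p x) -> 0 <= k ->
  (forall x, (0 <= f x)%E) -> measurable_fun [set: T] f ->
  (k%:E * \int[nu]_(x in D) f x <= \int[mu]_(x in D) f x)%E.
Proof.
move=> mup mp mD kp k0 f0 mf.
rewrite -[k]/(NngNum k0)%:num -ge0_integral_mscale//; last exact: measurable_funTS.
apply: ge0_le_measure_integral_in => // S mS SD.
rewrite mup//; apply: (@le_trans _ _ (\int[nu]_(x in S) cst k%:E x)%E);
  first by rewrite integral_cst.
apply: ge0_le_integral => //.
- exact/measurable_EFinP/measurable_funTS.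
- by move=> x /SD /kp; rewrite lee_fin.
Qed.

(** Triangle inequality through [c]: as [P] has mass 1, the distance from [c] to the mean is at most
    the integral of [|f - c|]. *)
Lemma integral_dist_mean_le d (T : measurableType d) (R : realType)
    (P : probability T R) (f : T -> R) (c : R) :
  measurable_fun [set: T] f ->
  (\int[P]_x `|f x - \int[P]_y f y|%:E <= 2%:E * \int[P]_x `|f x - c|%:E)%E.
Proof.
move=> mf; have mfc a : measurable_fun [set: T] (fun x => `|f x - a|%:E).
  by apply/measurable_EFinP; apply: measurableT_comp => //; exact: measurable_funB.
(* The infinite case goes first: there [f] is not integrable, and its real-valued mean carries no
   information. *)
have [->|] := eqVneq (\int[P]_x `|f x - c|%:E)%E +oo%E.
  by rewrite gt0_muley ?lte_fin// leey.
rewrite -ltey => foo.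
have ic : P.-integrable [set: T] (EFin \o cst c).
  exact: finite_measure_integrable_cst.
have ifc : P.-integrable [set: T] (EFin \o (fun x => f x - c)).
  by apply/integrableP; split=> //; apply/measurable_EFinP; exact: measurable_funB.
have if_ : P.-integrable [set: T] (EFin \o f).
  have := integrableD measurableT ifc ic.
  by apply: eq_integrable => // x _; rewrite /= -EFinD subrK.
have cE : \int[P]_x cst c x = c.
  have PT : fine (P [set: T]) = 1 by rewrite probability_setT.
  by rewrite -[RHS]mulr1 -PT; exact: Rintegral_cst.
have mean_c : (`|c - \int[P]_y f y|%:E <= \int[P]_x `|f x - c|%:E)%E.
  rewrite -{1}cE distrC -RintegralB// EFin_normr_Rintegral//.
  by apply: le_abse_integral => //; exact: measurable_int ifc.
apply: (@le_trans _ _ (\int[P]_x (`|f x - c|%:E + `|c - \int[P]_y f y|%:E))%E).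
  apply: ge0_le_integral => //.
  - by apply: emeasurable_funD => //; exact: mfc.
  - by move=> x _; rewrite -EFinD lee_fin; exact: ler_distD.
rewrite ge0_integralD//.
rewrite -[2]/(1 + 1) EFinD ge0_muleDl// mul1e leeD2l// (le_trans _ mean_c)//.
rewrite (_ : integral _ _ _ = (`|c - \int[P]_y f y|%:E * P [set: T])%E); last first.
  exact: integral_cst.
by rewrite probability_setT mule1.
Qed.

(** A Markov bound on the set where [W > L], followed by absorption of the [b] term; finiteness of
    the integral of [h] permits the subtraction. *)
Lemma le_integral_low_level d (T : measurableType d) (R : realType)
    (mu : {measure set T -> \bar R}) (h W : T -> R) (a b L : R) :
  measurable_fun [set: T] h -> measurable_fun [set: T] W ->
  (forall x, 0 <= h x) -> (forall x, 0 <= W x) ->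
  (\int[mu]_x (h x)%:E < +oo)%E ->
  (\int[mu]_x (h x * W x)%:E <= a%:E + b%:E * \int[mu]_x (h x)%:E)%E ->
  0 <= a -> 2 <= L -> 2 * b <= L ->
  (\int[mu]_x (h x)%:E <=
    2%:E * \int[mu]_(x in [set x | (W x <= L)%R]) (h x)%:E + a%:E)%E.
Proof.
move=> mh mW h0 W0 hoo hW a0 L2 bL.
pose D := [set x | W x <= L].
have mD : measurable D.
  by rewrite -[D]setTI; apply: measurable_fun_le => //; exact: measurable_cst.
have mhE E : measurable_fun E (fun x => (h x)%:E).
  by apply: measurable_funTS; exact/measurable_EFinP.
have split_h : (\int[mu]_x (h x)%:E =
    \int[mu]_(x in D) (h x)%:E + \int[mu]_(x in ~` D) (h x)%:E)%E.
  rewrite -ge0_integral_setU//.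
  - by rewrite setUv.
  - exact: measurableC.
  - by move=> x _; rewrite lee_fin.
  - by apply/disj_setPS; rewrite setICr.
have fin E : measurable E -> (\int[mu]_(x in E) (h x)%:E)%E \is a fin_num.
  move=> mE; rewrite ge0_fin_numE; last by apply: integral_ge0 => x _; rewrite lee_fin.
  apply: le_lt_trans hoo; apply: ge0_subset_integral => // x _.
  by rewrite lee_fin.
have tail : (L%:E * \int[mu]_(x in ~` D) (h x)%:E <= \int[mu]_x (h x * W x)%:E)%E.
  have mC := measurableC mD.
  have hWm : measurable_fun [set: T] (fun x => (h x * W x)%:E).
    by apply/measurable_EFinP; exact: measurable_funM.
  rewrite -ge0_integralZl//; last 2 first.
  - by move=> x _; rewrite lee_fin.
  - by rewrite lee_fin; lra.
  apply: (@le_trans _ _ (\int[mu]_(x in ~` D) (h x * W x)%:E)%E).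
    apply: ge0_le_integral => //.
    - by move=> x _; rewrite mule_ge0// lee_fin//; lra.
    - by apply: measurable_funeM; exact: mhE.
    - exact: measurable_funTS.
    - move=> x /negP; rewrite -ltNge => LW.
      by rewrite -EFinM lee_fin mulrC ler_wpM2l// ltW.
  by apply: ge0_subset_integral => // x _; rewrite lee_fin mulr_ge0.
move: hW (le_trans tail hW) split_h => _.
rewrite -/D -(fineK (fin _ measurableT)) -(fineK (fin _ mD)).
rewrite -(fineK (fin _ (measurableC mD))).
have : 0 <= fine (\int[mu]_x (h x)%:E).
  by apply: fine_ge0; apply: integral_ge0 => x _; rewrite lee_fin.
have : 0 <= fine (\int[mu]_(x in D) (h x)%:E).
  by apply: fine_ge0; apply: integral_ge0 => x _; rewrite lee_fin.
have : 0 <= fine (\int[mu]_(x in ~` D) (h x)%:E).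
  by apply: fine_ge0; apply: integral_ge0 => x _; rewrite lee_fin.
(* Let T, S, V be the integrals of [h] over the space, [D] and its complement. From
   [L V <= a + b T], [T = S + V] and [2 b <= L] comes [V <= S + 2 a / L], which is at most [S + a]
   as [L >= 2]. *)
set t := fine _; set s := fine _; set u := fine _ => t0 s0 u0.
rewrite -!EFinM -!EFinD !lee_fin => H [E].
by nra.
Qed.

(** A zero normalisation would make the density 0, since [0^-1 = 0], against the total mass 1. *)
Lemma normalisation_gt0 (R : realType) (N : nat) (U : 'rV[R]_N -> R)
    (mu : probability 'rV[R]_N R) :
  has_gibbs_density U mu -> 0 < normalisation U.
Proof.
move=> hmu; rewrite lt0r; apply/andP; split; last first.
  by apply: Rintegral_ge0 => x _; exact: expR_ge0.
apply/eqP => Z0; have := probability_setT mu; rewrite hmu// Z0.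
under eq_integral do rewrite invr0 mulr0.
by rewrite integral0 => /eqP; rewrite eq_sym onee_eq0.
Qed.

(** Monotone convergence: [|damp (harmonic n) t|] increases to [|t|], so a bound uniform in [n]
    passes to the limit. *)
Lemma le_integral_of_damp d (T : measurableType d) (R : realType)
    (mu : {measure set T -> \bar R}) (g : T -> R) (C : \bar R) :
  measurable_fun [set: T] g ->
  (forall n, (\int[mu]_x `|damp (harmonic n) (g x)|%:E <= C)%E) ->
  (\int[mu]_x `|g x|%:E <= C)%E.
Proof.
move=> mg gC; pose h n x := `|damp (harmonic n) (g x)|%:E.
have mh n : measurable_fun [set: T] (h n).
  apply/measurable_EFinP; apply: measurableT_comp => //.
  apply: (measurableT_comp (continuous_measurable_fun _)) => // t.
  apply: differentiable_continuous; apply/derivable1_diffP.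
  by have [] := is_derive_damp t (harmonic_ge0 n).
have h0 n x : [set: T] x -> (0 <= h n x)%E by move=> _; rewrite lee_fin.
have ndh x : [set: T] x -> {homo h^~ x : n m / (n <= m)%N >-> (n <= m)%E}.
  move=> _ n m nm; rewrite lee_fin normr_damp_le//; first exact: harmonic_ge0.
  by rewrite lef_pV2 ?posrE ?ltr0n// ler_nat ltnS.
have := @cvg_monotone_convergence _ _ _ mu _ measurableT _ mh h0 ndh.
rewrite (_ : (fun x => limn (h^~ x)) = (fun x => `|g x|%:E)).
  move=> hg; rewrite -(cvg_lim _ hg)//.
  by apply: lime_le; [apply/cvg_ex; eexists; exact: hg|exact: nearW].
apply/funext => x; apply/cvg_lim => //; apply: cvg_EFin; first exact: nearW.
by apply: cvg_norm; exact: cvg_damp.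
Qed.

(** * The L1 Poincaré inequality for [mu] *)

Unset Implicit Arguments.

Theorem theorem2p6 (R : realType) (N m : nat)
    (d : 'rV[R]_N -> 'rV[R]_N -> R)
    (hd : is_metric d)
    (hball : forall r : R, measurable (dball d r))
    (X : 'I_m -> 'rV[R]_N -> 'rV[R]_N)
    (hX : forall i x, differentiable (X i) x)
    (hdiv : forall i x, divergence (X i) x = 0)
    (U : 'rV[R]_N -> R)
    (hU : measurable_fun [set: 'rV[R]_N] U)
    (mu : probability 'rV[R]_N R)
    (hmu : has_gibbs_density U mu)
    (beta A B : R)
    (hbeta : 0 < beta)
    (hUbound : forall f : 'rV[R]_N -> R, (forall x, differentiable f x) ->
      mu.-integrable [set: 'rV[R]_N] (fun x => (subgrad_norm X f x)%:E) ->
      mu.-integrable [set: 'rV[R]_N] (fun x => (f x)%:E) ->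
      (\int[mu]_x (`|f x| * `|U x| `^ beta)%:E <=
        A%:E * \int[mu]_x (subgrad_norm X f x)%:E
        + B%:E * \int[mu]_x `|f x|%:E)%E)
    (r : R -> R)
    (ha : forall L : R, 0 <= L ->
      0 < r L /\ [set x | `|U x| `^ beta <= L] `<=` dball d (r L))
    (hloc : forall L : R, 0 <= L ->
      exists M : R, forall x, dball d (r L) x -> U x <= M)
    (hb : forall L : R, 0 <= L -> exists2 m_r : R, 0 < m_r &
      forall f : 'rV[R]_N -> R, (forall x, differentiable f x) ->
      (\int[lebesgue_rV R N]_(x in dball d (r L))
          `|f x - lebesgue_mean (dball d (r L)) f|%:E <=
        m_r^-1%:E *
          \int[lebesgue_rV R N]_(x in dball d (r L)) (subgrad_norm X f x)%:E)%E) :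
  exists c0 : R,
    forall f : 'rV[R]_N -> R, (forall x, differentiable f x) ->
    (\int[mu]_x `|f x - \int[mu]_y f y|%:E <=
      c0%:E * \int[mu]_x (subgrad_norm X f x)%:E)%E.
Proof.
have Z0 := normalisation_gt0 hmu.
pose W x := `|U x| `^ beta; pose p x := expR (- U x) / normalisation U.
have mW : measurable_fun [set: 'rV[R]_N] W.
  apply: (measurableT_comp (measurable_powR beta)).
  exact: measurableT_comp.
have mp : measurable_fun [set: 'rV[R]_N] p.
  apply: measurable_funM => //.
  apply: (@measurableT_comp _ _ _ _ _ _ expR _ (fun x => - U x)).
    exact: measurable_expR.
  exact: measurableT_comp.
have p0 x : 0 <= p x by rewrite divr_ge0 ?expR_ge0// ltW.
(* Chosen to satisfy both [2 <= L] and [2 * B <= L], as [le_integral_low_level] asks. *)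
pose L := 2 * (`|B| + 1).
have L0 : 0 <= L by rewrite mulr_ge0// addr_ge0.
have [_ DB] := ha L L0; have [M UM] := hloc L L0; have [q q0 hq] := hb L L0.
set D := [set x | _] in DB; set b := dball d (r L) in DB UM hq.
have mD : measurable D.
  by rewrite -[D]setTI; apply: measurable_fun_le => //; exact: measurable_cst.
(* On [D] one has [|U| <= L^(1/beta)], which bounds [- U] from above. *)
pose K := expR (L `^ beta^-1) / normalisation U.
have K0 : 0 <= K by rewrite divr_ge0 ?expR_ge0// ltW.
have pK x : D x -> p x <= K.
  move=> Dx; rewrite ler_pM2r ?invr_gt0// ler_expR.
  apply: le_trans (ler_norm _) _; rewrite normrN.
  rewrite -[leLHS]powRr1// -(@mulfV _ beta) ?gt_eqF// powRrM.
  by rewrite ge0_ler_powR ?nnegrE ?powR_ge0 ?invr_ge0 ?(ltW hbeta).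
pose k := expR (- M) / normalisation U.
have k0 : 0 < k by rewrite divr_gt0 ?expR_gt0.
have kp x : b x -> k <= p x.
  by move=> bx; rewrite ler_pM2r ?invr_gt0// ler_expR lerN2; exact: UM.
(* Twice the constant of [low], by [le_integral_low_level], plus the gradient coefficient; [|A|]
   stands for [A], whose sign is unknown. *)
pose C := 2 * (K * (q^-1 * k^-1)) + `|A|.
have C0 : 0 <= C.
  by rewrite addr_ge0// !mulr_ge0// invr_ge0 ltW.
(* The 2 comes from [integral_dist_mean_le]; the added 1 makes the constant positive, so that its
   product with an infinite gradient integral is [+oo]. *)
exists (2 * C + 1) => f df.
have cX i : continuous (X i).
  by move=> x; exact: differentiable_continuous.
have mf : measurable_fun [set: 'rV[R]_N] f.
  by apply: continuous_rV_measurable_fun => x; exact: differentiable_continuous.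
have mgf := measurable_subgrad_norm cX df.
set I := (\int[mu]_x (subgrad_norm X f x)%:E)%E.
have I0 : (0 <= I)%E.
  by apply: integral_ge0 => x _; rewrite lee_fin subgrad_norm_ge0.
have [->|] := eqVneq I +oo%E.
  by rewrite gt0_muley ?leey// lte_fin; lra.
rewrite -ltey => Ioo.
have igf : mu.-integrable [set: 'rV[R]_N] (fun x => (subgrad_norm X f x)%:E).
  apply/integrableP; split; first exact/measurable_EFinP.
  by under eq_integral do rewrite gee0_abs ?lee_fin ?subgrad_norm_ge0//.
pose c := lebesgue_mean b f.
apply: le_trans (integral_dist_mean_le mu c mf) _.
have mfc : measurable_fun [set: 'rV[R]_N] (fun x => `|f x - c|).
  by apply: measurableT_comp => //; exact: measurable_funB.
have mb : measurable b by exact: hball.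
(* Pass from [mu] on [D] to Lebesgue measure at cost [K], enlarge [D] to the ball, apply its
   Poincaré inequality, and return to [mu] at cost [k^-1]. *)
have low : (\int[mu]_(x in D) `|f x - c|%:E <= (K * (q^-1 * k^-1))%:E * I)%E.
  have fc0 x : (0 <= `|f x - c|%:E)%E by rewrite lee_fin.
  have emfc : measurable_fun [set: 'rV[R]_N] (fun x => `|f x - c|%:E).
    exact/measurable_EFinP.
  apply: le_trans (integral_density_le hmu mp p0 mD pK K0 fc0 emfc) _.
  rewrite (EFinM K) -muleA lee_wpmul2l ?lee_fin//.
  apply: (@le_trans _ _ (\int[lebesgue_rV R N]_(x in b) `|f x - c|%:E)%E).
    by apply: ge0_subset_integral => //; exact: measurable_funTS.
  apply: le_trans (hq f df) _.
  rewrite (EFinM q^-1) -muleA lee_wpmul2l ?lee_fin ?invr_ge0 ?(ltW q0)//.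
  rewrite lee_pdivlMl//.
  have gf0 x : (0 <= (subgrad_norm X f x)%:E)%E.
    by rewrite lee_fin subgrad_norm_ge0.
  have emgf : measurable_fun [set: 'rV[R]_N] (fun x => (subgrad_norm X f x)%:E).
    exact/measurable_EFinP.
  apply: le_trans (integral_density_ge hmu mp mb kp (ltW k0) gf0 emgf) _.
  exact: ge0_subset_integral.
have aI : (`|A|%:E * I = (`|A| * fine I)%:E)%E.
  by rewrite EFinM fineK// ge0_fin_numE.
(* Absorption for any integrable [g] dominated by [f - c], with gradient dominated by that of [f];
   [C] does not depend on [g]. *)
have int_le g : (forall x, differentiable g x) ->
    mu.-integrable [set: 'rV[R]_N] (fun x => (g x)%:E) ->
    (forall x, subgrad_norm X g x <= subgrad_norm X f x) ->
    (forall x, `|g x| <= `|f x - c|) -> (\int[mu]_x `|g x|%:E <= C%:E * I)%E.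
  move=> dg ig gradg gfc.
  have mgg := measurable_subgrad_norm cX dg.
  have igg : mu.-integrable [set: 'rV[R]_N] (fun x => (subgrad_norm X g x)%:E).
    apply: (le_integrable measurableT _ _ igf).
      by apply/measurable_EFinP; exact: mgg.
    by move=> x _; rewrite /= lee_fin !ger0_norm ?subgrad_norm_ge0.
  have /integrableP[/measurable_EFinP mg goo] := ig.
  have mag : measurable_fun [set: 'rV[R]_N] (fun x => `|g x|).
    exact: measurableT_comp.
  have I'I : (\int[mu]_x (subgrad_norm X g x)%:E <= I)%E.
    apply: ge0_le_integral.
    - exact: measurableT.
    - by move=> x _; rewrite lee_fin subgrad_norm_ge0.
    - by apply/measurable_EFinP; exact: mgg.
    - by apply/measurable_EFinP; exact: mgf.
    - by move=> x _; rewrite lee_fin.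
  have I'0 : (0 <= \int[mu]_x (subgrad_norm X g x)%:E)%E.
    by apply: integral_ge0 => x _; rewrite lee_fin subgrad_norm_ge0.
  have A0 : (0 <= `|A|%:E)%E by rewrite lee_fin.
  have gW : (\int[mu]_x (`|g x| * W x)%:E <=
      (`|A| * fine I)%:E + B%:E * \int[mu]_x `|g x|%:E)%E.
    apply: le_trans (hUbound g dg igg ig) _; rewrite -aI.
    apply: leeD; last exact: lexx.
    apply: (@le_trans _ _ (`|A|%:E * \int[mu]_x (subgrad_norm X g x)%:E)%E).
      by apply: lee_wpmul2r => //; rewrite lee_fin ler_norm.
    exact: (lee_wpmul2l A0 I'I).
  have W0 x : 0 <= W x by exact: powR_ge0.
  have g0 x : 0 <= `|g x| by [].
  have a0 : 0 <= `|A| * fine I by exact: mulr_ge0 (normr_ge0 A) (fine_ge0 I0).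
  have L2 : 2 <= L by rewrite /L ler_peMr// lerDr.
  have BL : 2 * B <= L by rewrite /L ler_pM2l// (le_trans (ler_norm _))// lerDl.
  apply: le_trans (le_integral_low_level mag mW g0 W0 goo gW a0 L2 BL) _.
  rewrite -aI /C (EFinD _ `|A|) ge0_muleDl; last 2 first.
  - by rewrite lee_fin !mulr_ge0// invr_ge0 ltW.
  - exact: A0.
  apply: leeD; last exact: lexx.
  rewrite (EFinM 2) -muleA; apply: lee_wpmul2l; first by rewrite lee_fin.
  apply: le_trans low; apply: ge0_le_integral => //.
  - exact/measurable_EFinP/measurable_funTS.
  - exact/measurable_EFinP/measurable_funTS.
  - by move=> x _; rewrite lee_fin.
have damp_le n : (\int[mu]_x `|damp (harmonic n) (f x - c)|%:E <= C%:E * I)%E.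
  have e0 : 0 <= harmonic n :> R by exact: harmonic_ge0.
  pose phi u := damp (harmonic n) (u - c).
  have dphi u : differentiable phi u.
    by apply/derivable1_diffP; have [] := derive_damp_le1 c u e0.
  have dg x : differentiable (phi \o f) x by exact: differentiable_comp.
  apply: (int_le (phi \o f)) => //.
  (* The damped function is bounded by [(harmonic n)^-1], hence integrable for the finite measure
     [mu]. *)
  - apply: (@measurable_bounded_integrable _ _ _ _ (phi \o f)) => //.
    + by rewrite (le_lt_trans (probability_le1 _ _))// ltey.
    + apply: continuous_rV_measurable_fun => x.
      exact: differentiable_continuous.
    + exists (harmonic n)^-1; split; first exact: num_real.
      move=> t nt x _; apply: le_trans (ltW nt); apply: normr_damp_ub.
      by rewrite harmonic_gt0/= invf_le1// ler1n.
  - move=> x; apply: subgrad_norm_comp_le => //.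
    by have [] := derive_damp_le1 c (f x) e0.
  (* [f - c] is its own damping with parameter 0, so monotonicity in the parameter applies. *)
  - by move=> x; rewrite -[X in _ <= `|X|]damp0; exact: normr_damp_le.
have fcI : (\int[mu]_x `|f x - c|%:E <= C%:E * I)%E.
  by apply: le_integral_of_damp => //; exact: measurable_funB.
apply: (@le_trans _ _ (2%:E * (C%:E * I))%E).
  by apply: lee_wpmul2l => //; rewrite lee_fin.
rewrite muleA -EFinM; apply: lee_wpmul2r => //.
by rewrite lee_fin lerDl.
Qed.
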